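(* Let $n\ge 2$ and let $A(t)$, $t\in\mathbb{R}$, be a line in the vector space $\mathcal{M}(n)$ of real $n\times n$ matrices (i.e. $A(t)=A_0+tA_1$ for fixed $A_0,A_1\in\mathcal{M}(n)$). Then $\{A(t)\mid t\in\mathbb{R}\}\subset\mathsf{SL}(n)$ if and only if $A(t)=B(I+tM)$, where $B\in\mathsf{SL}(n)$ and $M\in\mathcal{M}(n)$ is nilpotent.
   Context: $\mathsf{SL}(n)=\{A\in\mathcal{M}(n):\det A=1\}$. A matrix $M$ is nilpotent if $M^k=0$ for some positive integer $k$. *)

(* Defs.v *)
From mathcomp Require Import all_boot all_order all_algebra.
From mathcomp Require Import classical_sets reals.

Set Implicit Arguments.
Unset Strict Implicit.
Unset Printing Implicit Defensive.

Import GRing.Theory.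
Local Open Scope ring_scope.
Local Open Scope classical_set_scope.

Definition SL (R : realType) (n : nat) : set 'M[R]_n :=
  [set A | \det A = 1].
Arguments SL : clear implicits.

Definition nilpotent_mx (R : realType) (n : nat) (M : 'M[R]_n) : Prop :=
  exists k : nat, (0 < k)%N /\ M ^+ k = 0.

(* The direction A1 may be zero. *)
Definition is_line (R : realType) (n : nat) (A : R -> 'M[R]_n) : Prop :=
  exists A0 A1 : 'M[R]_n, forall t : R, A t = A0 + t *: A1.

(* Main.v *)
(* If det (1 + tM) = 1 for all t, then det (x - M) = x^n for all x <> 0, so the
   characteristic polynomial of M is X^n and M^n = 0 by Cayley-Hamilton.
   Conversely, if M is nilpotent then 1 + XM is invertible over R[X] (geometric
   series), so its determinant is a unit of R[X], i.e. a constant, and its value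
   at 0 is 1. *)
Require Import Defs.
From mathcomp Require Import all_boot all_order all_algebra.
From mathcomp Require Import classical_sets reals.

Import GRing.Theory Num.Theory.

Local Open Scope ring_scope.
Local Open Scope classical_set_scope.

(** In characteristic zero the numbers 1, ..., [size p] are distinct and nonzero, and a nonzero [p]
    has fewer than [size p] roots. *)
Lemma poly_eq0_of_nonzero_roots (F : numDomainType) (p : {poly F}) :
  (forall x : F, x != 0 -> p.[x] = 0) -> p = 0.
Proof.
move=> p0; apply: (@roots_geq_poly_eq0 _ p [seq i.+1%:R | i <- iota 0 (size p)]).
- by apply/allP => _ /mapP[i _ ->]; apply/rootP/p0; rewrite pnatr_eq0.
- by rewrite map_inj_uniq ?iota_uniq// => i j /mulrIn - /(_ (oner_neq0 _)) [].
- by rewrite size_map size_iota.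
Qed.

Lemma horner_char_poly (F : fieldType) (n : nat) (M : 'M[F]_n) (x : F) :
  (char_poly M).[x] = \det (x%:M - M).
Proof.
rewrite -horner_evalE -det_map_mx; congr (\det _); apply/matrixP => i j.
by rewrite !mxE /= horner_evalE !hornerE hornerMn hornerX.
Qed.

Lemma char_poly_det1_line (F : numFieldType) (n : nat) (M : 'M[F]_n) :
  (forall t : F, \det (1%:M + t *: M) = 1) -> char_poly M = 'X^n.
Proof.
move=> detM; apply/eqP; rewrite -subr_eq0; apply/eqP.
apply: poly_eq0_of_nonzero_roots => x x0.
rewrite hornerD hornerN hornerXn horner_char_poly.
(* The hypothesis is used at t = -1/x; pulling the scalar x out of the determinant yields x^n. *)
have -> : x%:M - M = x *: (1%:M + (- x^-1) *: M).
  by rewrite scalerDr scalemx1 scalerA mulrN divff// scaleN1r.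
by rewrite detZ detM mulr1 subrr.
Qed.

Lemma char_polyXn_expr0 (F : fieldType) (n : nat) (M : 'M[F]_n.+1) :
  char_poly M = 'X^(n.+1) -> M ^+ n.+1 = 0.
Proof.
by move=> cM; rewrite -(Cayley_Hamilton M) cM rmorphXn /= horner_mx_X.
Qed.

Lemma det_1D_nilpotent (F : idomainType) (n k : nat) (M : 'M[F]_n.+1) (t : F) :
  M ^+ k = 0 -> \det (1%:M + t *: M) = 1.
Proof.
move=> Mk.
(* The sign makes 1 - N = 1 + XM, the form inverted by a geometric series. *)
pose N : 'M[{poly F}]_n.+1 := - ('X *: map_mx polyC M).
have Nk : N ^+ k = 0.
  by rewrite /N -scaleNr exprZn -rmorphXn Mk /= map_mx0 scaler0.
pose p := \det (1 - N).
have hornerp x : p.[x] = \det (1%:M + x *: M).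
  rewrite -horner_evalE -det_map_mx; congr (\det _); apply/matrixP => i j.
  by rewrite !mxE /= horner_evalE !hornerE hornerMn !hornerE opprK mulrC.
have : p \is a GRing.unit.
  apply/unitrPr; exists (\det (\sum_(i < k) N ^+ i)).
  have := subrX1 N k; rewrite Nk sub0r -opprB mulNr => /oppr_inj geom.
  by rewrite -det_mulmx -[_ *m _]geom det1.
rewrite poly_unitE => /andP[/size_poly1P[c _ pc] _].
(* As [p] is constant, its value at t may be replaced by its value at 0. *)
rewrite -hornerp pc hornerC -(hornerC c 0) -pc hornerp.
by rewrite scale0r addr0 det1.
Qed.

Theorem lemma3p1 (R : realType) (n : nat) (hn : (2 <= n)%N)
    (A : R -> 'M[R]_n) (hA : is_line A) :
  [set A t | t in [set: R]] `<=` SL R n <->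
  exists B M : 'M[R]_n,
    [/\ SL R n B, nilpotent_mx M &
        forall t : R, A t = B *m (1%:M + t *: M)].
Proof.
case: n hn A hA => // n _ A [A0 [A1 defA]]; split.
- move=> AinSL.
  have detA t : \det (A t) = 1 by apply: AinSL; exists t.
  have detA0 : \det A0 = 1 by rewrite -(detA 0) defA scale0r addr0.
  have uA0 : A0 \in unitmx by rewrite unitmxE detA0 unitr1.
  (* Setting t = 0 forces B = A0, and comparing the terms in t then forces M = A0^-1 A1. *)
  have defA' t : A t = A0 *m (1%:M + t *: (invmx A0 *m A1)).
    by rewrite mulmxDr mulmx1 -scalemxAr mulKVmx.
  exists A0, (invmx A0 *m A1); split=> //.
  exists n.+1; split=> //.
  apply: char_polyXn_expr0; apply: char_poly_det1_line => t.
  by have := detA t; rewrite defA' det_mulmx detA0 mul1r.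
- move=> [B [M [detB [k [_ Mk]] eqA]]] _ [t _ <-].
  by rewrite /SL /= eqA det_mulmx detB mul1r (det_1D_nilpotent _ _ _ _ _ Mk).
Qed.
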